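(* (Connection formulae.) Let $\mu$ be a complex Borel measure on $\mathbb{T}^D$ and $L$ a Laurent polynomial with $\ell(L)=m$ such that both $\mu$ and $T\,d\mu=L\,d\mu$ are quasi-definite. Write $\phi_{[l,m]}=(\phi_{[l]};\dots;\phi_{[l+m-1]})$ (stacked column), and similarly $\hat\phi_{[l,m]}$, $T\phi_{[l,m]}$, $T\hat\phi_{[l,m]}$. Then $$K^{(l+m)}(z_1,z_2)=L(z_2)\,TK^{(l+m)}(z_1,z_2)-\big(T\hat\phi_{[l,m]}(z_1)\big)^\dagger(TH^{[l,m]})^{-1}\omega_{[l,m]}\,\phi_{[l+m,m]}(z_2)$$ $$=L(z_2)\,TK^{(l)}(z_1,z_2)+\big(T\hat\phi_{[l,m]}(z_1)\big)^\dagger(TH^{[l,m]})^{-1}\omega^{[l,m]}\,\phi_{[l,m]}(z_2)$$ $$=\bar L(z_1^{-1})\,TK^{(l+m)}(z_1,z_2)-\big(\hat\phi_{[l+m,m]}(z_1)\big)^\dagger(\hat\omega_{[l,m]})^\dagger(TH^{[l,m]})^{-1}\,T\phi_{[l,m]}(z_2)$$ $$=\bar L(z_1^{-1})\,TK^{(l)}(z_1,z_2)+\big(\hat\phi_{[l,m]}(z_1)\big)^\dagger(\hat\omega^{[l,m]})^\dagger(TH^{[l,m]})^{-1}\,T\phi_{[l,m]}(z_2).$$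
   Context: Let $D\ge1$, $z(\theta)=(e^{i\theta_1},\dots,e^{i\theta_D})$; $z_1,z_2\in(\mathbb{C}^* )^D$ and $l\ge0$. For $\alpha\in\mathbb{Z}^D$ put $|\alpha|=\sum_a|\alpha_a|$, $z^\alpha=\prod_a z_a^{\alpha_a}$, $[k]=\{\alpha:|\alpha|=k\}$. Multi-indices are ordered by $|\alpha|$ and lexicographically inside each $[k]$; $\chi(z)$ is the semi-infinite column of all monomials in this order. Semi-infinite matrices have the corresponding block structure $A_{[k],[l]}$; $A^{[k]}$ denotes truncation to blocks $0,\dots,k-1$. The moment matrix is $G=\oint_{\mathbb{T}^D}\chi(z(\theta))d\mu(\theta)\chi(z(\theta))^\dagger$; $\mu$ is quasi-definite if $\det G^{[k]}\ne0$ for all $k\ge1$, and then uniquely $G=S^{-1}H(\hat S^{-1})^\dagger$ with $S,\hat S$ block lower unitriangular and $H=\operatorname{diag}(H_{[0]},H_{[1]},\dots)$ with invertible blocks. $\Phi=S\chi$, $\hat\Phi=\hat S\chi$ have blocks $\phi_{[k]},\hat\phi_{[k]}$. The Christoffel–Darboux kernel is $K^{(k)}(z_1,z_2)=\sum_{j=0}^{k-1}\hat\phi_{[j]}(z_1)^\dagger H_{[j]}^{-1}\phi_{[j]}(z_2)$. A prefix $T$ denotes the corresponding object for $L(z(\theta))d\mu(\theta)$. For $L=\sum L_\alpha z^\alpha$, $\ell(L)=\max\{|\alpha|:L_\alpha\neq0\}$, $\bar L(z)=\sum\overline{L_\alpha}z^\alpha$, so that $\bar L(z^{-1})=\sum\overline{L_\alpha}z^{-\alpha}$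 ($z^{-1}$ componentwise), and $L(\Upsilon)$ is the matrix with entries $(L(\Upsilon))_{\beta,\gamma}=L_{\gamma-\beta}$. The resolvents are $\omega=(TS)L(\Upsilon)S^{-1}$ and $\hat\omega=(T\hat S)L(\Upsilon)^\dagger\hat S^{-1}$; both are block upper triangular with all block superdiagonals above the $m$-th equal to zero. $\omega^{[l,m]}$ is the (block upper triangular) submatrix of $\omega$ with block rows $l,\dots,l+m-1$ and block columns $l,\dots,l+m-1$; $\omega_{[l,m]}$ is the (block lower triangular) submatrix with block rows $l,\dots,l+m-1$ and block columns $l+m,\dots,l+2m-1$; similarly for $\hat\omega$. $H^{[l,m]}=\operatorname{diag}(H_{[l]},\dots,H_{[l+m-1]})$.
   Formalization: In the third and fourth formulae the scalar $\bar L(z_1^{-1})$ is replaced by its complex conjugate $\overline{\bar L(z_1^{-1})}$; as printed they fail, e.g. for D=1, Lebesgue measure and L=i, where they would give K=-K. *)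

(* Defs.v *)
From HB Require Import structures.
From mathcomp Require Import all_boot all_order all_algebra.
From mathcomp Require Import finmap complex.
From mathcomp Require Import all_classical all_reals all_analysis.
From mathcomp Require Import zify.

Set Implicit Arguments.
Unset Strict Implicit.
Unset Printing Implicit Defensive.

Import Order.TTheory GRing.Theory Num.Theory.

Local Open Scope classical_set_scope.
Local Open Scope ring_scope.
Local Open Scope complex_scope.

(* By uniqueness of the Jordan decomposition, the value does not depend on the
   chosen Hahn decomposition. *)
Definition charge_integral {d : measure_display} {T : measurableType d}
    {R : realType} (nu : {charge set T -> \bar R}) (A : set T) (f : T -> R) : R :=
  let hP := cid (Hahn_decomposition nu) in
  let hN := cid (projT2 hP) in
  Rintegral (jordan_pos (projT2 hN)) A f - Rintegral (jordan_neg (projT2 hN)) A f.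

(* Charges are finite, so a complex measure is exactly a pair of charges. *)
Record complex_measure (d : measure_display) (T : measurableType d)
    (R : realType) := ComplexMeasure {
  re_measure : {charge set T -> \bar R};
  im_measure : {charge set T -> \bar R} }.

Definition complex_integral {d : measure_display} {T : measurableType d}
    {R : realType} (mu : complex_measure T R) (A : set T) (f : T -> R[i]) : R[i] :=
  (charge_integral (re_measure mu) A (fun x => complex.Re (f x))
   - charge_integral (im_measure mu) A (fun x => complex.Im (f x)))
  +i*
  (charge_integral (re_measure mu) A (fun x => complex.Im (f x))
   + charge_integral (im_measure mu) A (fun x => complex.Re (f x))).

(* The torus T^D is represented by the box [0, 2pi)^D, through the Borel
   isomorphism theta |-> z(theta). Measures live on the Borel sets of R^D but
   are only ever integrated over the box. *)
Definition torus_box (R : realType) (D : nat) : set (D.-tuple (measurableTypeR R)) :=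
  [set theta | forall a : 'I_D, 0 <= (tnth theta a : R) < 2 * pi].

Definition torus_measure (R : realType) (D : nat) :=
  complex_measure (D.-tuple (measurableTypeR R)) R.

Definition torus_pt {R : realType} {D : nat}
    (theta : D.-tuple (measurableTypeR R)) : 'I_D -> R[i] :=
  fun a => cos (tnth theta a : R) +i* sin (tnth theta a : R).

Definition multi (D : nat) := {ffun 'I_D -> int}.

Definition mlen (D : nat) (al : multi D) : nat := (\sum_(a < D) absz (al a))%N.

Definition mle (D : nat) : rel (multi D) :=
  fun al be => ([seq al a | a : 'I_D] <= [seq be a | a : 'I_D] :> seqlexi int)%O.

(* All entries of a multi-index of length k lie in {-k, ..., k}; see mem_block
   and block_sorted below. *)
Definition block (D k : nat) : seq (multi D) :=
  sort (@mle D)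
    [seq al <- [seq [ffun a => (f a)%:Z - k%:Z] | f : {ffun 'I_D -> 'I_(k.*2.+1)}]
           | mlen al == k].

Definition bsz (D k : nat) : nat := size (block D k).

Definition bnth (D k : nat) (i : 'I_(bsz D k)) : multi D := nth 0 (block D k) i.

Lemma mem_block (D k : nat) (al : multi D) : (al \in block D k) = (mlen al == k).
Proof.
rewrite mem_sort mem_filter; case: eqP => //= alk.
apply/mapP.
have bd a : (absz (al a) <= k)%N by rewrite -alk /mlen (bigD1 a) //= leq_addr.
have bd' a : (absz (al a + k%:Z)%R < k.*2.+1)%N by have := bd a; lia.
exists [ffun a => Ordinal (bd' a)]; first by rewrite mem_enum.
by apply/ffunP => a; rewrite !ffunE /=; have := bd a; lia.
Qed.

Lemma block_uniq (D k : nat) : uniq (block D k).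
Proof.
rewrite sort_uniq filter_uniq // map_inj_uniq ?enum_uniq // => f g /ffunP fg.
apply/ffunP => a; have := fg a; rewrite !ffunE => /addIr [] h; exact/val_inj.
Qed.

Lemma block_sorted (D k : nat) : sorted (@mle D) (block D k).
Proof. by apply: sort_sorted => al be; exact: le_total. Qed.

Definition laurent (R : realType) (D : nat) := {fsfun multi D -> R[i] with 0}.

Definition zpow {R : realType} {D : nat} (z : 'I_D -> R[i]) (al : multi D) : R[i] :=
  \prod_(a < D) z a ^ al a.

Definition zinv {R : realType} {D : nat} (z : 'I_D -> R[i]) : 'I_D -> R[i] :=
  fun a => (z a)^-1.

Definition leval {R : realType} {D : nat} (L : laurent R D) (z : 'I_D -> R[i]) : R[i] :=
  \sum_(al <- finsupp L) L al * zpow z al.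

Definition ell {R : realType} {D : nat} (L : laurent R D) : nat :=
  (\max_(al <- finsupp L) mlen al)%N.

Definition lbar {R : realType} {D : nat} (L : laurent R D) : laurent R D :=
  [fsfun al in finsupp L => Num.conj (L al) | 0].

Definition dag {R : realType} {m n : nat} (A : 'M[R[i]]_(m, n)) : 'M[R[i]]_(n, m) :=
  map_mx Num.conj A^T.

Definition bmx (R : realType) (D : nat) :=
  forall k l : nat, 'M[R[i]]_(bsz D k, bsz D l).

Definition bcol (R : realType) (D : nat) := forall k : nat, 'cV[R[i]]_(bsz D k).

(* The sums over the middle index are finitely supported sums; every product
   used below is of this kind, because of the triangular and banded shapes. *)
Definition bmul {R : realType} {D : nat} (A B : bmx R D) : bmx R D :=
  fun k l => \sum_(j \in [set: nat]) (A k j *m B j l).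

Definition bmulc {R : realType} {D : nat} (A : bmx R D) (v : bcol R D) : bcol R D :=
  fun k => \sum_(j \in [set: nat]) (A k j *m v j).

Definition bdag {R : realType} {D : nat} (A : bmx R D) : bmx R D :=
  fun k l => dag (A l k).

Definition btrunc {R : realType} {D : nat} (A : bmx R D) (k : nat)
    : 'M[R[i]]_(\sum_(i < k) bsz D i) :=
  \mxblock_(i < k, j < k) A i j.

(* Inverse of a block lower triangular matrix: its (k, l) block is that of the
   inverse of any truncation large enough to contain it. *)
Definition binv {R : realType} {D : nat} (A : bmx R D) : bmx R D :=
  fun k l =>
    let N := (maxn k l).+1 in
    submxblock (p_ := fun i : 'I_N => bsz D i) (q_ := fun j : 'I_N => bsz D j)
      (invmx (btrunc A N))
      (Ordinal (leq_maxl k l : (k < N)%N)) (Ordinal (leq_maxr k l : (l < N)%N)).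

Definition block_diagonal {R : realType} {D : nat} (A : bmx R D) : Prop :=
  forall k l : nat, k != l -> A k l = 0.

Definition block_lower_unitriangular {R : realType} {D : nat} (A : bmx R D) : Prop :=
  (forall k l : nat, (k < l)%N -> A k l = 0) /\ (forall k : nat, A k k = 1%:M).

Definition chi {R : realType} {D : nat} (z : 'I_D -> R[i]) : bcol R D :=
  fun k => \col_i zpow z (bnth i).

Definition lUpsilon {R : realType} {D : nat} (L : laurent R D) : bmx R D :=
  fun k l => \matrix_(i, j) L (bnth j - bnth i).

(* Moment matrix of the measure w(z(theta)) dmu(theta): w = 1 gives G and w = L
   gives TG. *)
Definition moment_matrix {R : realType} {D : nat} (mu : torus_measure R D)
    (w : ('I_D -> R[i]) -> R[i]) : bmx R D :=
  fun k l => \matrix_(i, j)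
    complex_integral mu (@torus_box R D) (fun theta =>
      let z := torus_pt theta in
      zpow z (bnth i) * w z * Num.conj (zpow z (bnth j))).

Definition quasi_definite {R : realType} {D : nat} (G : bmx R D) : Prop :=
  forall k : nat, (0 < k)%N -> \det (btrunc G k) != 0.

Record gauss_borel {R : realType} {D : nat} (G S H Sh : bmx R D) : Prop :=
  GaussBorel {
    gb_S : block_lower_unitriangular S;
    gb_Sh : block_lower_unitriangular Sh;
    gb_diag : block_diagonal H;
    gb_unit : forall k : nat, H k k \in unitmx;
    gb_fact : G = bmul (bmul (binv S) H) (bdag (binv Sh)) }.

(* phi S is phi and phi Sh is \hat phi. Since L(Upsilon)^dagger chi(z) is
   \bar L(z^{-1}) chi(z), one has \hat omega \hat phi(z) = \bar L(z^{-1}) T\hat phi(z);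
   the kernel contains the dagger of \hat phi(z_1), so there the scalar factor is
   the conjugate of \bar L(z_1^{-1}). *)
Definition phi {R : realType} {D : nat} (S : bmx R D) (z : 'I_D -> R[i]) : bcol R D :=
  bmulc S (chi z).

Definition CD_kernel {R : realType} {D : nat} (S H Sh : bmx R D) (k : nat)
    (z1 z2 : 'I_D -> R[i]) : R[i] :=
  \sum_(j < k) (dag (phi Sh z1 j) *m invmx (H j j) *m phi S z2 j) 0 0.

Definition resolvent {R : realType} {D : nat} (TS M S : bmx R D) : bmx R D :=
  bmul (bmul TS M) (binv S).

(* stack, diag_part, upper_part and lower_part are v_{[l,m]}, H^{[l,m]},
   omega^{[l,m]} and omega_{[l,m]}. *)
Definition stack {R : realType} {D : nat} (v : bcol R D) (l m : nat)
    : 'cV[R[i]]_(\sum_(i < m) bsz D (l + i)) :=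
  \mxcol_(i < m) v (l + i)%N.

Definition diag_part {R : realType} {D : nat} (H : bmx R D) (l m : nat)
    : 'M[R[i]]_(\sum_(i < m) bsz D (l + i)) :=
  \mxdiag_(i < m) H (l + i)%N (l + i)%N.

Definition upper_part {R : realType} {D : nat} (A : bmx R D) (l m : nat)
    : 'M[R[i]]_(\sum_(i < m) bsz D (l + i), \sum_(j < m) bsz D (l + j)) :=
  \mxblock_(i < m, j < m) A (l + i)%N (l + j)%N.

Definition lower_part {R : realType} {D : nat} (A : bmx R D) (l m : nat)
    : 'M[R[i]]_(\sum_(i < m) bsz D (l + i), \sum_(j < m) bsz D (l + m + j)) :=
  \mxblock_(i < m, j < m) A (l + i)%N (l + m + j)%N.

(* Main.v *)
(* On the torus conj (z^be) = z^(-be), so the perturbed moment matrix is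
   TG = L(Upsilon) G = G L(Upsilon). Inserting both Gauss-Borel factorizations
   into TG = L(Upsilon) G gives
     omega = TS L(Upsilon) S^-1 = TH (hat S (T hat S)^-1)^dagger H^-1:
   the left expression bounds the upper bandwidth of omega by m and shows
   omega Phi = L T Phi, the right one shows that omega is upper triangular and
   that (T hat Phi)^dagger TH^-1 omega = hat Phi^dagger H^-1. With
     c_ij = (T hat phi_i)^dagger TH_i^-1 omega_ij phi_j,
   K^(n) is the sum of c_ij over j < n and L(z_2) TK^(n) the sum over i < n;
   as c_ij = 0 unless i <= j <= i + m, they differ by the finite blocks of the
   statement. The two hat formulae follow by conjugation from the same argument
   for G^dagger, which exchanges S with hat S and L(Upsilon) with its dagger. *)

Require Import Defs.
From mathcomp Require Import all_boot all_order all_algebra.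
From mathcomp Require Import finmap complex.
From mathcomp Require Import all_classical all_reals all_analysis.
From mathcomp Require Import measurable_realfun zify ring.

Import Order.TTheory GRing.Theory Num.Theory.
Import numFieldNormedType.Exports.

Local Open Scope classical_set_scope.
Local Open Scope ring_scope.
Local Open Scope complex_scope.

Set Implicit Arguments.
Unset Strict Implicit.
Unset Printing Implicit Defensive.

(** * Linearity of the complex integral on bounded measurable functions *)

Section BoundedMeasurable.
Context {d : measure_display} {T : measurableType d} {R : realType}.

(** A class closed under sums and products and integrable for every finite measure; it contains the
    real and imaginary parts of all monomials on the torus. *)
Definition bounded_measurable (f : T -> R) : Prop :=
  measurable_fun [set: T] f /\ exists M, forall x, `|f x| <= M.

Lemma bounded_measurable_cst (a : R) : bounded_measurable (fun=> a).
Proof. by split; [exact: measurable_cst | exists `|a|]. Qed.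

Lemma bounded_measurableD (f g : T -> R) :
  bounded_measurable f -> bounded_measurable g ->
  bounded_measurable (fun x => f x + g x).
Proof.
move=> [mf [M fM]] [mg [N gN]]; split; first exact: measurable_funD.
by exists (M + N) => x; rewrite (le_trans (ler_normD _ _)) // lerD.
Qed.

Lemma bounded_measurableM (f g : T -> R) :
  bounded_measurable f -> bounded_measurable g ->
  bounded_measurable (fun x => f x * g x).
Proof.
move=> [mf [M fM]] [mg [N gN]]; split; first exact: measurable_funM.
by exists (M * N) => x; rewrite normrM ler_pM.
Qed.

Lemma bounded_measurableZ (a : R) (f : T -> R) :
  bounded_measurable f -> bounded_measurable (fun x => a * f x).
Proof. by move=> bf; apply: bounded_measurableM => //; exact: bounded_measurable_cst. Qed.

Lemma bounded_measurableN (f : T -> R) :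
  bounded_measurable f -> bounded_measurable (fun x => - f x).
Proof.
by move=> [mf [M fM]]; split; [exact: measurable_funN | exists M => x; rewrite normrN].
Qed.

Lemma bounded_measurable_integrable (nu : {finite_measure set T -> \bar R})
    (A : set T) (f : T -> R) :
  measurable A -> bounded_measurable f -> nu.-integrable A (EFin \o f).
Proof.
move=> mA [mf [M fM]]; apply: measurable_bounded_integrable => //.
- by rewrite ltey_eq fin_num_measure.
- exact: measurable_funTS.
- exists M; split; first exact: num_real.
  by move=> x Mx y _ /=; exact: le_trans (fM y) (ltW Mx).
Qed.

(** The chosen Hahn decomposition depends on [nu] alone, so the three integrals use the same two
    Jordan parts, and linearity for each finite part suffices. *)
Lemma charge_integral_linear (nu : {charge set T -> \bar R}) (A : set T)
    (a b : R) (f g : T -> R) :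
  measurable A -> bounded_measurable f -> bounded_measurable g ->
  charge_integral nu A (fun x => a * f x + b * g x) =
  a * charge_integral nu A f + b * charge_integral nu A g.
Proof.
move=> mA bf bg; rewrite /charge_integral.
set hN := cid _.
have lin (rho : {finite_measure set T -> \bar R}) :
    Rintegral rho A (fun x => a * f x + b * g x) =
    a * Rintegral rho A f + b * Rintegral rho A g.
  rewrite RintegralD //; try exact/bounded_measurable_integrable/bounded_measurableZ.
  by rewrite !RintegralZl //; exact: bounded_measurable_integrable.
by rewrite !lin; ring.
Qed.

Definition cbounded_measurable (f : T -> R[i]) : Prop :=
  bounded_measurable (fun x => complex.Re (f x)) /\
  bounded_measurable (fun x => complex.Im (f x)).

Lemma cbounded_measurable_cst (a : R[i]) : cbounded_measurable (fun=> a).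
Proof. by split; exact: bounded_measurable_cst. Qed.

Lemma cbounded_measurableD (f g : T -> R[i]) :
  cbounded_measurable f -> cbounded_measurable g ->
  cbounded_measurable (fun x => f x + g x).
Proof.
move=> [rf jf] [rg jg]; split.
- by under eq_fun do rewrite raddfD; exact: bounded_measurableD.
- by under eq_fun do rewrite raddfD; exact: bounded_measurableD.
Qed.

Lemma Re_mul (a b : R[i]) : complex.Re (a * b) =
  complex.Re a * complex.Re b - complex.Im a * complex.Im b.
Proof. by case: a b => [? ?] [? ?]. Qed.

Lemma Im_mul (a b : R[i]) : complex.Im (a * b) =
  complex.Re a * complex.Im b + complex.Im a * complex.Re b.
Proof. by case: a b => [? ?] [? ?]. Qed.

Lemma cbounded_measurableM (f g : T -> R[i]) :
  cbounded_measurable f -> cbounded_measurable g ->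
  cbounded_measurable (fun x => f x * g x).
Proof.
move=> [rf jf] [rg jg]; split.
- under eq_fun do rewrite Re_mul.
  apply: bounded_measurableD; first exact: bounded_measurableM.
  by apply: bounded_measurableN; exact: bounded_measurableM.
- under eq_fun do rewrite Im_mul.
  by apply: bounded_measurableD; exact: bounded_measurableM.
Qed.

Lemma cbounded_measurable_conj (f : T -> R[i]) :
  cbounded_measurable f -> cbounded_measurable (fun x => Num.conj (f x)).
Proof.
move=> [rf jf]; split.
- by rewrite (_ : (fun x => _) = fun x => complex.Re (f x)) //; apply/funext => x; case: (f x).
- rewrite (_ : (fun x => _) = fun x => - complex.Im (f x)).
    exact: bounded_measurableN.
  by apply/funext => x; case: (f x).
Qed.

Lemma cbounded_measurableX (f : T -> R[i]) (n : nat) :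
  cbounded_measurable f -> cbounded_measurable (fun x => f x ^+ n).
Proof.
move=> bf; elim: n => [|n IH]; first exact: cbounded_measurable_cst.
by under eq_fun do rewrite exprS; exact: cbounded_measurableM.
Qed.

Lemma cbounded_measurable_sum (I : Type) (s : seq I) (F : I -> T -> R[i]) :
  (forall i, cbounded_measurable (F i)) ->
  cbounded_measurable (fun x => \sum_(i <- s) F i x).
Proof.
move=> bF; elim: s => [|i s IH].
  by under eq_fun do rewrite big_nil; exact: cbounded_measurable_cst.
by under eq_fun do rewrite big_cons; exact: cbounded_measurableD.
Qed.

Lemma cbounded_measurable_prod (I : Type) (s : seq I) (F : I -> T -> R[i]) :
  (forall i, cbounded_measurable (F i)) ->
  cbounded_measurable (fun x => \prod_(i <- s) F i x).
Proof.
move=> bF; elim: s => [|i s IH].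
  by under eq_fun do rewrite big_nil; exact: cbounded_measurable_cst.
by under eq_fun do rewrite big_cons; exact: cbounded_measurableM.
Qed.

Lemma complex_integral_linear (mu : complex_measure T R) (A : set T)
    (c : R[i]) (f g : T -> R[i]) :
  measurable A -> cbounded_measurable f -> cbounded_measurable g ->
  complex_integral mu A (fun x => c * f x + g x) =
  c * complex_integral mu A f + complex_integral mu A g.
Proof.
move=> mA [rf jf] [rg jg]; rewrite /complex_integral.
(* The factors [1] give the integrand the shape of [charge_integral_linear], which then applies to
   the outer sum and to the inner one. *)
have ReE : (fun x => complex.Re (c * f x + g x)) = fun x =>
    1 * (complex.Re c * complex.Re (f x) + (- complex.Im c) * complex.Im (f x))
    + 1 * complex.Re (g x).
  by apply/funext => x; rewrite raddfD /= Re_mul; ring.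
have ImE : (fun x => complex.Im (c * f x + g x)) = fun x =>
    1 * (complex.Re c * complex.Im (f x) + complex.Im c * complex.Re (f x))
    + 1 * complex.Im (g x).
  by apply/funext => x; rewrite raddfD /= Im_mul; ring.
have bRe : bounded_measurable (fun x =>
    complex.Re c * complex.Re (f x) + (- complex.Im c) * complex.Im (f x)).
  by apply: bounded_measurableD; exact: bounded_measurableZ.
have bIm : bounded_measurable (fun x =>
    complex.Re c * complex.Im (f x) + complex.Im c * complex.Re (f x)).
  by apply: bounded_measurableD; exact: bounded_measurableZ.
rewrite ReE ImE !charge_integral_linear //.
case: c {ReE ImE bRe bIm} => cr ci; apply/eqP.
by rewrite eq_complex /=; apply/andP; split; apply/eqP; ring.
Qed.

Lemma complex_integral_sum (mu : complex_measure T R) (A : set T)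
    (I : Type) (s : seq I) (c : I -> R[i]) (F : I -> T -> R[i]) :
  measurable A -> (forall i, cbounded_measurable (F i)) ->
  complex_integral mu A (fun x => \sum_(i <- s) c i * F i x) =
  \sum_(i <- s) c i * complex_integral mu A (F i).
Proof.
move=> mA bF; elim: s => [|i s IH].
  rewrite big_nil; under eq_fun do rewrite big_nil.
  (* The integral of zero vanishes: linearity with coefficient [-1] and two zero functions writes it
     as minus itself plus itself. *)
  have := complex_integral_linear mu (-1) mA
    (cbounded_measurable_cst 0) (cbounded_measurable_cst 0).
  by under eq_fun do rewrite mulr0 addr0; move->; rewrite mulN1r addNr.
rewrite big_cons -IH -complex_integral_linear //.
  by under eq_fun do rewrite big_cons.
apply: cbounded_measurable_sum => j.
by apply: cbounded_measurableM => //; exact: cbounded_measurable_cst.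
Qed.

End BoundedMeasurable.

(** * Monomials and moments on the torus *)

Section Torus.
Context {R : realType} {D : nat}.
Implicit Types (al be : multi D) (L : laurent R D) (mu : torus_measure R D)
  (z : 'I_D -> R[i]).

Lemma zpowD z al be : (forall a, z a != 0) ->
  zpow z (al + be) = zpow z al * zpow z be.
Proof.
move=> z0; rewrite /zpow -big_split; apply: eq_bigr => a _ /=.
by rewrite ffunE expfzDr.
Qed.

Lemma zpow_zinv z al : zpow (zinv z) al = zpow z (- al).
Proof.
by apply: eq_bigr => a _; rewrite ffunE /zinv exprz_inv.
Qed.

Lemma torus_pt_mul_conj (th : D.-tuple (measurableTypeR R)) a :
  torus_pt th a * Num.conj (torus_pt th a) = 1.
Proof.
apply/eqP; rewrite eq_complex /= !mulrN opprK -!expr2 cos2Dsin2 eqxx /=.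
by rewrite mulrC addNr.
Qed.

Lemma torus_pt_neq0 (th : D.-tuple (measurableTypeR R)) a : torus_pt th a != 0.
Proof.
by have := torus_pt_mul_conj th a; case: eqP => // -> /eqP; rewrite mul0r eq_sym oner_eq0.
Qed.

Lemma torus_ptV (th : D.-tuple (measurableTypeR R)) a :
  (torus_pt th a)^-1 = Num.conj (torus_pt th a).
Proof.
by apply: (mulfI (torus_pt_neq0 th a)); rewrite torus_pt_mul_conj divff ?torus_pt_neq0.
Qed.

Lemma conj_zpow_torus (th : D.-tuple (measurableTypeR R)) al :
  Num.conj (zpow (torus_pt th) al) = zpow (torus_pt th) (- al).
Proof.
rewrite -zpow_zinv /zpow rmorph_prod; apply: eq_bigr => a _.
by rewrite rmorphXz ?unitfE ?torus_pt_neq0 //= /zinv torus_ptV.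
Qed.

Lemma measurable_torus_box : measurable (@torus_box R D).
Proof.
rewrite (_ : @torus_box R D = \bigcap_(a : 'I_D) ((@tnth D (measurableTypeR R))^~ a @^-1`
  [set` `[(0 : R), 2 * pi[])); last first.
  apply/seteqP; split=> [th h a _ | th h a]; first by rewrite /= in_itv /=; exact: h.
  by have := h a I; rewrite /= in_itv.
apply: fin_bigcap_measurable; first exact: finite_finset.
move=> a _; rewrite -[X in measurable X]setTI.
by apply: measurable_tnth => //; exact: measurable_itv.
Qed.

Lemma cbounded_measurable_torus_pt a :
  cbounded_measurable (fun th : D.-tuple (measurableTypeR R) => torus_pt th a).
Proof.
split; split.
- apply: (@measurableT_comp _ _ _ _ _ _ (@cos R)) => //.
    by apply: continuous_measurable_fun; exact: continuous_cos.
  exact: measurable_tnth.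
- exists 1 => th; rewrite /torus_pt /= ler_norml.
  by rewrite cos_geN1 cos_le1.
- apply: (@measurableT_comp _ _ _ _ _ _ (@sin R)) => //.
    by apply: continuous_measurable_fun; exact: continuous_sin.
  exact: measurable_tnth.
- exists 1 => th; rewrite /torus_pt /= ler_norml.
  by rewrite sin_geN1 sin_le1.
Qed.

Lemma cbounded_measurable_zpow al :
  cbounded_measurable (fun th : D.-tuple (measurableTypeR R) => zpow (torus_pt th) al).
Proof.
apply: cbounded_measurable_prod => a.
case: (al a) => n; first exact/cbounded_measurableX/cbounded_measurable_torus_pt.
(* On the unit circle the inverse is the conjugate, so negative powers stay bounded and
   measurable. *)
under eq_fun do rewrite NegzE -exprz_inv torus_ptV.
exact/cbounded_measurableX/cbounded_measurable_conj/cbounded_measurable_torus_pt.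
Qed.

(** The Fourier coefficients of [mu]: an entry of the moment matrix depends only on the difference
    of its two multi-indices. *)
Definition moment mu al : R[i] :=
  complex_integral mu (@torus_box R D) (fun th => zpow (torus_pt th) al).

(** Conjugation negates exponents on the torus, so each term of [L] turns the integrand into a
    single monomial, and the finite sum leaves the integral. *)
Lemma moment_matrixE mu L k l i j :
  moment_matrix mu (leval L) k l i j =
  \sum_(ga <- finsupp L) L ga * moment mu (bnth i + ga - bnth j).
Proof.
rewrite mxE -complex_integral_sum; last 2 first.
- exact: measurable_torus_box.
- by move=> ga; exact: cbounded_measurable_zpow.
congr complex_integral; apply/funext => th /=.
rewrite /leval mulr_sumr mulr_suml; apply: eq_bigr => ga _.
rewrite conj_zpow_torus -addrA !zpowD //; try by move=> a; exact: torus_pt_neq0.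
by ring.
Qed.

Lemma moment_matrix1E mu k l i j :
  moment_matrix mu (fun=> 1) k l i j = moment mu (bnth i - bnth j).
Proof.
rewrite mxE; congr complex_integral; apply/funext => th /=.
by rewrite mulr1 conj_zpow_torus -zpowD // => a; exact: torus_pt_neq0.
Qed.

End Torus.

(** * Finitely supported sums and sums over a band *)

Section BandedSum.
Context {V : zmodType}.

Lemma sum_ord_zero_tail (n N : nat) (F : nat -> V) : (n <= N)%N ->
  (forall j, (n <= j)%N -> F j = 0) -> \sum_(j < N) F j = \sum_(j < n) F j.
Proof.
move=> /subnKC <- F0; rewrite big_split_ord /= [X in _ + X]big1 ?addr0 // => i _.
by rewrite F0 // leq_addr.
Qed.

Lemma fsum_nat (N : nat) (F : nat -> V) :
  (forall j, (N <= j)%N -> F j = 0) -> \sum_(j \in [set: nat]) F j = \sum_(j < N) F j.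
Proof.
move=> F0; rewrite -(big_mkord xpredT F) (fsbigE (index_iota 0 N)) ?iota_uniq //=.
  by apply: eq_bigl => i; rewrite in_setT.
by move=> i _; rewrite mem_index_iota /= -leqNgt => /F0.
Qed.

(** Extending the columns from [l + m] to [l + m + m] adds only a square: in these new columns the
    band forces the row index to be at least [l]. *)
Lemma banded_sum_lower (c : nat -> nat -> V) (l m : nat) :
  (forall i j, (j < i)%N || (i + m < j)%N -> c i j = 0) ->
  \sum_(j < l + m) \sum_(i < l + m) c i j =
  \sum_(i < l + m) \sum_(j < l + m + m) c i j
  - \sum_(i < m) \sum_(j < m) c (l + i)%N (l + m + j)%N.
Proof.
move=> c0; rewrite exchange_big /=.
under [in RHS]eq_bigr do rewrite big_split_ord /=.
rewrite big_split /= [X in _ + X - _]big_split_ord /= [X in _ + (X + _)]big1 ?add0r ?addrK //.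
by move=> i _; rewrite big1 // => j _; rewrite c0 //; case: i => /=; lia.
Qed.

(** The rows from [l] on vanish in the columns before [l], so they contribute only a diagonal
    square. *)
Lemma banded_sum_upper (c : nat -> nat -> V) (l m : nat) :
  (forall i j, (j < i)%N || (i + m < j)%N -> c i j = 0) ->
  \sum_(j < l + m) \sum_(i < l + m) c i j =
  \sum_(i < l) \sum_(j < l + m) c i j
  + \sum_(i < m) \sum_(j < m) c (l + i)%N (l + j)%N.
Proof.
move=> c0; rewrite exchange_big /= big_split_ord /=; congr (_ + _).
apply: eq_bigr => i _; rewrite big_split_ord /= big1 ?add0r // => j _.
by rewrite c0 //; case: j => /=; lia.
Qed.

End BandedSum.

(** * Conjugate transposes and block diagonal inverses *)

Section ConjugateTranspose.
Context {R : realType}.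

Lemma dag_mul {m n p : nat} (A : 'M[R[i]]_(m, n)) (B : 'M[R[i]]_(n, p)) :
  dag (A *m B) = dag B *m dag A.
Proof. by rewrite /dag trmx_mul map_mxM. Qed.

Lemma dagK {m n : nat} (A : 'M[R[i]]_(m, n)) : dag (dag A) = A.
Proof. by apply/matrixP => i j; rewrite !mxE conjCK. Qed.

Lemma dagE {m n : nat} (A : 'M[R[i]]_(m, n)) i j : dag A i j = Num.conj (A j i).
Proof. by rewrite !mxE. Qed.

Lemma dag0 {m n : nat} : dag (0 : 'M[R[i]]_(m, n)) = 0.
Proof. by apply/matrixP => i j; rewrite !mxE rmorph0. Qed.

Lemma dag_sum {m n : nat} (I : Type) (s : seq I) (F : I -> 'M[R[i]]_(m, n)) :
  dag (\sum_(i <- s) F i) = \sum_(i <- s) dag (F i).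
Proof. by rewrite /dag raddf_sum map_mx_sum. Qed.

Lemma dag_inv {n : nat} (A : 'M[R[i]]_n) : dag (invmx A) = invmx (dag A).
Proof. by rewrite /dag trmx_inv map_invmx. Qed.

Lemma dag_unitmx {n : nat} (A : 'M[R[i]]_n) : (dag A \in unitmx) = (A \in unitmx).
Proof. by rewrite /dag map_unitmx unitmx_tr. Qed.

Lemma dag_mxcol {m n : nat} {p_ : 'I_m -> nat} (B : forall i, 'M[R[i]]_(p_ i, n)) :
  dag (\mxcol_i B i) = \mxrow_i dag (B i).
Proof. by apply/matrixP => i j; rewrite !mxE. Qed.

Lemma map_mxblock {S T : Type} (f : S -> T) {p q : nat} {p_ : 'I_p -> nat}
    {q_ : 'I_q -> nat} (B : forall i j, 'M[S]_(p_ i, q_ j)) :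
  map_mx f (\mxblock_(i, j) B i j) = \mxblock_(i, j) map_mx f (B i j).
Proof. by apply/matrixP => i j; rewrite !mxE. Qed.

Lemma dag_mxdiag {m : nat} {p_ : 'I_m -> nat} (B : forall i, 'M[R[i]]_(p_ i)) :
  dag (\mxdiag_i B i) = \mxdiag_i dag (B i).
Proof.
rewrite /dag tr_mxdiag /mxdiag map_mxblock; apply: eq_mxblock => i j.
case: eqP => [e|_]; last by rewrite map_mx0.
by case: _ / e; rewrite !conform_mx_id.
Qed.

End ConjugateTranspose.

Lemma invmx_mxdiag {F : fieldType} {m : nat} {p_ : 'I_m -> nat}
    (B : forall i, 'M[F]_(p_ i)) : (forall i, B i \in unitmx) ->
  invmx (\mxdiag_i B i) = \mxdiag_i invmx (B i).
Proof.
move=> uB.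
have BV : \mxdiag_i B i *m \mxdiag_i invmx (B i) = 1%:M.
  rewrite [X in _ *m X]/mxdiag mul_mxdiag_mxblock -mxdiagZ; apply: eq_mxblock => i j.
  by case: eqP => [e|_]; rewrite ?mulmx0 //; case: _ / e; rewrite !conform_mx_id mulmxV.
have [uD _] := mulmx1_unit BV.
by rewrite -[RHS]mul1mx -(mulVmx uD) -mulmxA BV mulmx1.
Qed.

(** * Algebra of semi-infinite block matrices *)

Section BlockMatrices.
Context {R : realType} {D : nat}.
Implicit Types (A B C : bmx R D) (v : bcol R D) (al be : multi D).

Lemma bmxP A B : (forall k l, A k l = B k l) -> A = B.
Proof.
by move=> AB; do 2!(apply: functional_extensionality_dep => ?); exact: AB.
Qed.

Lemma bcolP (v w : bcol R D) : (forall k, v k = w k) -> v = w.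
Proof. exact: functional_extensionality_dep. Qed.

Lemma bmulE A B (k l N : nat) :
  (forall j, (N <= j)%N -> A k j *m B j l = 0) ->
  bmul A B k l = \sum_(j < N) A k j *m B j l.
Proof. exact: fsum_nat. Qed.

Lemma bmulcE A v (k N : nat) :
  (forall j, (N <= j)%N -> A k j *m v j = 0) ->
  bmulc A v k = \sum_(j < N) A k j *m v j.
Proof. exact: fsum_nat. Qed.

(** Makes the middle sum of a product with left factor [A] genuinely finite; a sum with infinite
    support would take the default value [0]. *)
Definition row_finite A : Prop :=
  forall k, exists N, forall j, (N <= j)%N -> A k j = 0.

Lemma row_finite_uniform A n : row_finite A ->
  exists N, forall k j, (k < n)%N -> (N <= j)%N -> A k j = 0.
Proof.
move=> fA; elim: n => [|n [N AN]]; first by exists 0%N.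
have [M AM] := fA n; exists (maxn N M) => k j.
rewrite ltnS leq_eqVlt geq_max => /predU1P[-> | kn] /andP[Nj Mj]; first exact: AM.
exact: AN.
Qed.

(* The core of every associativity law below; [v] stands either for a column
   of blocks of a matrix or for a block column. *)
Lemma fsum_mulA {p : nat} A B (v : forall k, 'M[R[i]]_(bsz D k, p)) (k N M : nat) :
  (forall j, (N <= j)%N -> A k j = 0) ->
  (forall j i, (j < N)%N -> (M <= i)%N -> B j i *m v i = 0) ->
  \sum_(i \in [set: nat]) (bmul A B k i *m v i) =
  \sum_(j \in [set: nat]) (A k j *m \sum_(i \in [set: nat]) (B j i *m v i)).
Proof.
move=> A0 B0.
have AB i : bmul A B k i *m v i = \sum_(j < N) A k j *m (B j i *m v i).
  rewrite (@bmulE _ _ _ _ N) => [|j /A0 ->]; last by rewrite mul0mx.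
  by rewrite mulmx_suml; apply: eq_bigr => j _; rewrite mulmxA.
rewrite (@fsum_nat _ M) => [|i Mi]; last first.
  by rewrite AB big1 // => j _; rewrite B0 ?mulmx0.
rewrite [RHS](@fsum_nat _ N) => [|j /A0 ->]; last by rewrite mul0mx.
under eq_bigr do rewrite AB; rewrite exchange_big /=; apply: eq_bigr => j _.
by rewrite -mulmx_sumr (@fsum_nat _ M) // => i; exact: B0.
Qed.

Lemma bmulA A B C : row_finite A -> row_finite B ->
  bmul (bmul A B) C = bmul A (bmul B C).
Proof.
move=> fA fB; apply: bmxP => k l.
have [N A0] := fA k; have [M B0] := row_finite_uniform N fB.
by apply: (@fsum_mulA _ _ _ (fun i => C i l) _ N M A0) => j i jN Mi; rewrite B0 ?mul0mx.
Qed.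

(** Here finiteness of the columns of [C] bounds the inner sum instead of the rows of [B]; this
    covers right factors that are daggers of lower triangular matrices. *)
Lemma bmulA_colfin A B C : row_finite A -> row_finite (bdag C) ->
  bmul (bmul A B) C = bmul A (bmul B C).
Proof.
move=> fA fC; apply: bmxP => k l.
have [N A0] := fA k; have [M C0] := fC l.
apply: (@fsum_mulA _ _ _ (fun i => C i l) _ N M A0) => j i _ Mi.
by rewrite -(dagK (C i l)) [dag (C i l)]C0 // dag0 mulmx0.
Qed.

Lemma bmulcA A B v : row_finite A -> row_finite B ->
  bmulc (bmul A B) v = bmulc A (bmulc B v).
Proof.
move=> fA fB; apply: bcolP => k.
have [N A0] := fA k; have [M B0] := row_finite_uniform N fB.
by apply: (fsum_mulA (M := M) A0) => j i jN Mi; rewrite B0 ?mul0mx.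
Qed.

Lemma row_finite_bmul A B : row_finite A -> row_finite B -> row_finite (bmul A B).
Proof.
move=> fA fB k; have [N A0] := fA k; have [M B0] := row_finite_uniform N fB.
exists M => l Ml; rewrite (@bmulE _ _ _ _ N) => [|j /A0 ->]; last by rewrite mul0mx.
by rewrite big1 // => j _; rewrite B0 ?mulmx0.
Qed.

Lemma bdagK A : bdag (bdag A) = A.
Proof.
by apply: bmxP => k l; rewrite /bdag dagK.
Qed.

Lemma bdag_bmul A B : row_finite A -> bdag (bmul A B) = bmul (bdag B) (bdag A).
Proof.
move=> fA; apply: bmxP => k l.
rewrite /bdag; have [N A0] := fA l.
rewrite (@bmulE _ _ _ _ N) => [|j /A0 ->]; last by rewrite mul0mx.
rewrite dag_sum [RHS](@bmulE _ _ _ _ N) => [|j /A0 ->]; last by rewrite dag0 mulmx0.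
by apply: eq_bigr => j _; rewrite dag_mul.
Qed.

(** The identity, defined by comparing multi-indices so that diagonal and rectangular off-diagonal
    blocks share one formula without a cast. *)
Definition bone : bmx R D := fun k l => \matrix_(i, j) (bnth i == bnth j)%:R.

Lemma mlen_bnth (k : nat) (i : 'I_(bsz D k)) : mlen (bnth i) = k.
Proof. by apply/eqP; rewrite -mem_block mem_nth. Qed.

Lemma bone_diag k : bone k k = 1%:M.
Proof.
apply/matrixP => i j; rewrite !mxE; congr (nat_of_bool _)%:R.
by rewrite /bnth nth_uniq ?block_uniq //; exact: ltn_ord.
Qed.

Lemma bone_offdiag : block_diagonal bone.
Proof.
move=> k l kl; apply/matrixP => i j; rewrite !mxE; case: eqP => // e.
by move: kl; rewrite -(mlen_bnth i) e mlen_bnth eqxx.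
Qed.

Lemma sum_block_diag {p : nat} A (v : forall k, 'M[R[i]]_(bsz D k, p)) (k : nat) :
  (forall j, k != j -> A k j = 0) ->
  \sum_(j \in [set: nat]) (A k j *m v j) = A k k *m v k.
Proof.
move=> A0; rewrite (@fsum_nat _ k.+1) => [|j kj]; last by rewrite A0 ?mul0mx ?ltn_eqF.
by rewrite big_ord_recr /= big1 ?add0r // => j _; rewrite A0 ?mul0mx ?gtn_eqF.
Qed.

Lemma bmul_diagl A B k l : block_diagonal A -> bmul A B k l = A k k *m B k l.
Proof. by move=> dA; exact: (sum_block_diag (fun j => B j l) (dA k)). Qed.

Lemma bdag_diag A : block_diagonal A -> block_diagonal (bdag A).
Proof. by move=> dA k l kl; rewrite /bdag dA ?dag0 // eq_sym. Qed.

Lemma row_finite_diag A : block_diagonal A -> row_finite A.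
Proof. by move=> dA k; exists k.+1 => j kj; rewrite dA // ltn_eqF. Qed.

Lemma bmul_diagr A B k l : block_diagonal B -> bmul A B k l = A k l *m B l l.
Proof.
move=> dB; rewrite (@bmulE _ _ _ _ l.+1) => [|j lj]; last by rewrite dB ?mulmx0 ?gtn_eqF.
by rewrite big_ord_recr /= big1 ?add0r // => j _; rewrite dB ?mulmx0 ?ltn_eqF.
Qed.

Lemma bmul1 A : bmul bone A = A.
Proof.
apply: bmxP => k l.
by rewrite (bmul_diagl _ _ _ bone_offdiag) bone_diag mul1mx.
Qed.

Lemma bmulr1 A : bmul A bone = A.
Proof.
apply: bmxP => k l.
by rewrite (bmul_diagr _ _ _ bone_offdiag) bone_diag mulmx1.
Qed.

Lemma bmulc1 v : bmulc bone v = v.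
Proof.
apply: bcolP => k.
by rewrite /bmulc sum_block_diag ?bone_diag ?mul1mx // => j; exact: bone_offdiag.
Qed.

Lemma bdag1 : bdag bone = bone.
Proof.
apply: bmxP => k l.
by apply/matrixP => i j; rewrite !mxE eq_sym rmorph_nat.
Qed.

Definition block_lower A : Prop := forall k l, (k < l)%N -> A k l = 0.

Lemma row_finite_lower A : block_lower A -> row_finite A.
Proof. by move=> lA k; exists k.+1 => j; exact: lA. Qed.

Lemma bmul_lower A B : block_lower A -> block_lower B -> block_lower (bmul A B).
Proof.
move=> lA lB k l kl; rewrite (@bmulE _ _ _ _ k.+1) => [|j kj]; last by rewrite lA ?mul0mx.
by rewrite big1 // => j _; rewrite lB ?mulmx0 //; have := ltn_ord j; lia.
Qed.

(* One step of forward substitution for [A X = 1]. *)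
Definition forward_step A (X : bmx R D) : bmx R D :=
  fun k l => bone k l - \sum_(j < k) A k j *m X j l.

(** Row [k] of the solution depends only on earlier rows, so [k.+1] rounds starting from zero
    already determine it. *)
Definition forward_inv A : bmx R D :=
  fun k => iter k.+1 (forward_step A) (fun _ _ => 0) k.

Lemma forward_invE A k l : forward_inv A k l = forward_step A (forward_inv A) k l.
Proof.
(* Rounds after the first [k'.+1] no longer change row [k']. *)
have iterE n k' X : (k' < n)%N ->
    iter n (forward_step A) X k' = iter k'.+1 (forward_step A) X k'.
  elim/ltn_ind: n k' X => -[//|n] IH k' X kn.
  apply: functional_extensionality_dep => l' /=; congr (_ - _).
  apply: eq_bigr => j _.
  rewrite !IH //; have := ltn_ord j; lia.
rewrite {1}/forward_inv /=; congr (_ - _); apply: eq_bigr => j _.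
by rewrite iterE.
Qed.

Lemma forward_inv_lower A : block_lower (forward_inv A).
Proof.
move=> k; elim/ltn_ind: k => k IH l kl.
rewrite forward_invE /forward_step bone_offdiag ?ltn_eqF // sub0r big1 ?oppr0 // => j _.
by rewrite IH ?mulmx0 // (ltn_trans _ kl).
Qed.

Lemma sum_forward_inv A (k l N : nat) : block_lower_unitriangular A -> (k < N)%N ->
  \sum_(j < N) A k j *m forward_inv A j l = bone k l.
Proof.
move=> [lA uA] kN; rewrite (sum_ord_zero_tail (F := fun j => A k j *m forward_inv A j l) kN).
  by rewrite big_ord_recr /= uA mul1mx [in X in _ + X]forward_invE addrC subrK.
by move=> j kj; rewrite lA ?mul0mx.
Qed.

Lemma btrunc_bone N : btrunc bone N = 1%:M.
Proof.
rewrite -mxdiagZ; apply: eq_mxblock => i j; case: eqP => [e|/eqP ij].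
  by case: _ / e; rewrite conform_mx_id bone_diag.
by rewrite bone_offdiag.
Qed.

Lemma btrunc_mul_forward_inv A N : block_lower_unitriangular A ->
  btrunc A N *m btrunc (forward_inv A) N = 1%:M.
Proof.
move=> ltA; rewrite mul_mxblock -btrunc_bone; apply: eq_mxblock => i j.
exact: sum_forward_inv.
Qed.

(** Every truncation of [forward_inv A] inverts the same truncation of [A], so the blocks of
    [binv A] do not depend on the size of the truncation. *)
Lemma binvE A : block_lower_unitriangular A -> binv A = forward_inv A.
Proof.
move=> ltA; apply: bmxP => k l.
rewrite /binv; set N := (maxn _ _).+1.
have AX := btrunc_mul_forward_inv N ltA; have [uA _] := mulmx1_unit AX.
have -> : invmx (btrunc A N) = btrunc (forward_inv A) N.
  by rewrite -[RHS]mul1mx -(mulVmx uA) -mulmxA AX mulmx1.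
by rewrite mxblockK.
Qed.

Lemma binv_lower A : block_lower_unitriangular A -> block_lower (binv A).
Proof. by move=> /binvE ->; exact: forward_inv_lower. Qed.

Lemma bmul_binvr A : block_lower_unitriangular A -> bmul A (binv A) = bone.
Proof.
move=> ltA; apply: bmxP => k l.
rewrite (binvE ltA) (@bmulE _ _ _ _ k.+1) ?sum_forward_inv // => j kj.
by rewrite ltA.1 ?mul0mx.
Qed.

Lemma bmul_binvl A : block_lower_unitriangular A -> bmul (binv A) A = bone.
Proof.
move=> ltA; apply: bmxP => k l.
set N := (maxn k l).+1.
have kN : (k < N)%N by rewrite ltnS leq_maxl.
have lN : (l < N)%N by rewrite ltnS leq_maxr.
(* For finite square matrices a right inverse is also a left inverse; the block [(k, l)] of this
   identity is the one required. *)
have := mulmx1C (btrunc_mul_forward_inv N ltA).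
rewrite mul_mxblock -btrunc_bone /btrunc => /eq_mxblockP/(_ (Ordinal kN) (Ordinal lN))/= <-.
rewrite (binvE ltA) (@bmulE _ _ _ _ N) // => j Nj.
by rewrite forward_inv_lower ?mul0mx // (leq_trans kN).
Qed.

Lemma block_lower_mul_binv A B : block_lower_unitriangular A ->
  block_lower_unitriangular B -> block_lower (bmul A (binv B)).
Proof. by move=> [lA _] ltB; apply: bmul_lower => //; exact: binv_lower. Qed.

End BlockMatrices.

(** * Resolvents and Christoffel-Darboux kernels *)

Section Connection.
Context {R : realType} {D : nat}.
Implicit Types (G S H Sh TG TS TH TSh M : bmx R D) (z : 'I_D -> R[i]).

(** Transfers every result on [S] to [Sh], and so yields the two hat formulae. *)
Lemma gauss_borel_dag G S H Sh :
  gauss_borel G S H Sh -> gauss_borel (bdag G) Sh (bdag H) S.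
Proof.
move=> [ltS ltSh dH uH ->]; split => //; first exact: bdag_diag.
  by move=> k; rewrite /bdag dag_unitmx.
have fs := row_finite_lower (binv_lower ltS); have fH := row_finite_diag dH.
rewrite bdag_bmul; last exact: row_finite_bmul.
rewrite bdag_bmul // bdagK -bmulA //.
- exact/row_finite_lower/binv_lower.
- exact/row_finite_diag/bdag_diag.
Qed.

(** * Connection formulae for a band matrix [M], later [lUpsilon L] or its dagger *)

Section Perturbation.
Variables (m : nat) (G S H Sh TG TS TH TSh M : bmx R D).
Hypotheses (fact : gauss_borel G S H Sh) (Tfact : gauss_borel TG TS TH TSh).
Hypotheses (TGE : TG = bmul M G).
Hypothesis bandM : forall k l, (k + m < l)%N -> M k l = 0.

Let ltS := gb_S fact.
Let ltSh := gb_Sh fact.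
Let ltTS := gb_S Tfact.
Let ltTSh := gb_Sh Tfact.
Let fS := row_finite_lower ltS.1.
Let fSh := row_finite_lower ltSh.1.
Let fTS := row_finite_lower ltTS.1.
Let fTSh := row_finite_lower ltTSh.1.
Let fs := row_finite_lower (binv_lower ltS).
Let fsh := row_finite_lower (binv_lower ltSh).
Let fts := row_finite_lower (binv_lower ltTS).
Let ftsh := row_finite_lower (binv_lower ltTSh).
Let fH := row_finite_diag (gb_diag fact).
Let fTH := row_finite_diag (gb_diag Tfact).

Let fM : row_finite M.
Proof. by move=> k; exists (k + m).+1 => l; exact: bandM. Qed.

Let fTSM : row_finite (bmul TS M). Proof. exact: row_finite_bmul. Qed.

Let omega := resolvent TS M S.

Let fomega : row_finite omega. Proof. exact: row_finite_bmul. Qed.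

Lemma resolvent_mul_diag :
  bmul omega H = bmul TH (bdag (bmul Sh (binv TSh))).
Proof.
(* Both sides equal [TS] times [TG]: the left one by regrouping [G] and using [TGE], the right one
   by cancelling [TS] against its inverse. *)
have key : bmul (bmul omega H) (bdag (binv Sh)) = bmul TH (bdag (binv TSh)).
  rewrite bmulA // /omega /resolvent bmulA // -(bmulA _ fs fH) -(gb_fact fact).
  rewrite bmulA // -TGE (gb_fact Tfact) -bmulA //; last exact: row_finite_bmul.
  by rewrite -[bmul TS _]bmulA // bmul_binvr // bmul1.
(* Inserting the dagger of [Sh] times its inverse on the right makes the left side of [key] appear.
   These right factors are upper triangular, hence the column-finite associativity. *)
rewrite -[LHS]bmulr1 -bdag1 -(bmul_binvr ltSh) [bdag (bmul Sh _)]bdag_bmul //.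
rewrite -bmulA_colfin ?bdagK //; last exact: row_finite_bmul.
by rewrite key bmulA_colfin ?bdagK // [in RHS]bdag_bmul.
Qed.

Lemma resolventE i j :
  omega i j = TH i i *m dag (bmul Sh (binv TSh) j i) *m invmx (H j j).
Proof.
have := congr1 (fun A : bmx R D => A i j) resolvent_mul_diag.
rewrite (bmul_diagr _ _ _ (gb_diag fact)) (bmul_diagl _ _ _ (gb_diag Tfact)) => <-.
by rewrite mulmxK // (gb_unit fact).
Qed.

Lemma resolvent_lower_zero i j : (j < i)%N -> omega i j = 0.
Proof.
by move=> ji; rewrite resolventE block_lower_mul_binv // dag0 mulmx0 mul0mx.
Qed.

Lemma resolvent_band i j : (i + m < j)%N -> omega i j = 0.
Proof.
(* Cutting the middle index [p] at [j] kills everything: for [p >= j] the block of [TS M] is beyond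
   the band, and for [p < j] that of [binv S] is above the diagonal. *)
move=> imj; rewrite /omega /resolvent (@bmulE _ _ _ _ _ _ j) => [|p jp]; last first.
  rewrite (@bmulE _ _ _ _ _ _ i.+1) => [|q iq]; last by rewrite ltTS.1 ?mul0mx.
  rewrite big1 ?mul0mx // => q _; rewrite bandM ?mulmx0 //.
  by have := ltn_ord q; lia.
by rewrite big1 // => p _; rewrite binv_lower ?mulmx0.
Qed.

(** The inverse of [S] takes [phi S z] back to [chi z], an eigenvector of [M], and [TS] then
    produces the perturbed polynomials. *)
Lemma resolvent_phi z (c : R[i]) : bmulc M (chi z) = (fun k => c *: chi z k) ->
  bmulc omega (phi S z) = (fun k => c *: phi TS z k).
Proof.
move=> Mchi; rewrite /omega /resolvent /phi bmulcA // -(bmulcA _ fs fS).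
rewrite bmul_binvl // bmulc1 bmulcA // Mchi; apply: bcolP => k.
rewrite (@bmulcE _ _ _ _ _ k.+1) => [|j kj]; last by rewrite ltTS.1 ?mul0mx.
rewrite (@bmulcE _ _ _ _ _ k.+1) => [|j kj]; last by rewrite ltTS.1 ?mul0mx.
by rewrite scaler_sumr; apply: eq_bigr => j _; rewrite -scalemxAr.
Qed.

Lemma mul_binv_phi z : bmulc (bmul Sh (binv TSh)) (phi TSh z) = phi Sh z.
Proof. by rewrite /phi bmulcA // -(bmulcA _ ftsh fTSh) bmul_binvl // bmulc1. Qed.

Variables (z1 z2 : 'I_D -> R[i]) (c : R[i]).
Hypothesis Mchi : bmulc M (chi z2) = (fun k => c *: chi z2 k).

Let term i j : R[i] :=
  (dag (phi TSh z1 i) *m invmx (TH i i) *m omega i j *m phi S z2 j) 0 0.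

Let term0 i j : (j < i)%N || (i + m < j)%N -> term i j = 0.
Proof.
rewrite /term => /orP[ji|imj].
  by rewrite resolvent_lower_zero // mulmx0 mul0mx mxE.
by rewrite resolvent_band // mulmx0 mul0mx mxE.
Qed.

(** Expanding [phi Sh z1 j] in the perturbed dual polynomials involves only indices up to [j]; by
    [resolventE] the coefficients become blocks of [omega]. *)
Lemma CD_kernel_term j N : (j < N)%N ->
  (dag (phi Sh z1 j) *m invmx (H j j) *m phi S z2 j) 0 0 = \sum_(i < N) term i j.
Proof.
move=> jN; rewrite -mul_binv_phi (@bmulcE _ _ _ _ _ N) => [|i Ni]; last first.
  by rewrite block_lower_mul_binv ?mul0mx // (leq_trans jN).
rewrite dag_sum !mulmx_suml summxE; apply: eq_bigr => i _; rewrite /term.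
by rewrite dag_mul resolventE !mulmxA mulmxKV // (gb_unit Tfact).
Qed.

Lemma scaled_CD_kernel_term i N : (i + m < N)%N ->
  c * (dag (phi TSh z1 i) *m invmx (TH i i) *m phi TS z2 i) 0 0 =
  \sum_(j < N) term i j.
Proof.
move=> imN; transitivity ((c *: (dag (phi TSh z1 i) *m invmx (TH i i) *m phi TS z2 i)) 0 0).
  by rewrite [RHS]mxE.
rewrite scalemxAr.
rewrite -[c *: phi TS z2 i]/((fun k => c *: phi TS z2 k) i) -(resolvent_phi Mchi).
rewrite (@bmulcE _ _ _ _ _ N) => [|j Nj]; last first.
  by rewrite resolvent_band ?mul0mx // (leq_trans imN).
by rewrite mulmx_sumr summxE; apply: eq_bigr => j _; rewrite !mulmxA.
Qed.

(** A free column offset [l'] treats [upper_part] ([l' = l]) and [lower_part] ([l' = l + m])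
    together. *)
Lemma stack_form l l' (A : 'M[R[i]]_(\sum_(i < m) bsz D (l + i), \sum_(j < m) bsz D (l' + j))) :
  A = \mxblock_(i < m, j < m) omega (l + i)%N (l' + j)%N ->
  (dag (stack (phi TSh z1) l m) *m invmx (diag_part TH l m) *m A
   *m stack (phi S z2) l' m) 0 0 =
  \sum_(i < m) \sum_(j < m) term (l + i)%N (l' + j)%N.
Proof.
move=> ->; rewrite dag_mxcol invmx_mxdiag => [|i]; last exact: (gb_unit Tfact).
rewrite mul_mxrow_mxdiag mul_mxrow_mxblock mul_mxrow_mxcol summxE exchange_big /=.
by apply: eq_bigr => j _; rewrite mulmx_suml summxE; apply: eq_bigr => i _.
Qed.

Lemma CD_kernel_connection l :
  CD_kernel S H Sh (l + m) z1 z2 =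
    c * CD_kernel TS TH TSh (l + m) z1 z2
    - (dag (stack (phi TSh z1) l m) *m invmx (diag_part TH l m)
       *m lower_part omega l m *m stack (phi S z2) (l + m) m) 0 0 /\
  CD_kernel S H Sh (l + m) z1 z2 =
    c * CD_kernel TS TH TSh l z1 z2
    + (dag (stack (phi TSh z1) l m) *m invmx (diag_part TH l m)
       *m upper_part omega l m *m stack (phi S z2) l m) 0 0.
Proof.
have KE : CD_kernel S H Sh (l + m) z1 z2 =
    \sum_(j < l + m) \sum_(i < l + m) term i j.
  by apply: eq_bigr => j _; exact: CD_kernel_term.
(* Rows [i < n] of the band end before column [n + m], so this one bound serves all of them. *)
have TKE n : c * CD_kernel TS TH TSh n z1 z2 =
    \sum_(i < n) \sum_(j < n + m) term i j.
  by rewrite mulr_sumr; apply: eq_bigr => i _;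
    apply: scaled_CD_kernel_term; rewrite ltn_add2r.
split; rewrite KE (@stack_form l) // TKE.
- exact: banded_sum_lower.
- exact: banded_sum_upper.
Qed.

End Perturbation.

(** The adjoint problem has the conjugate kernel with exchanged arguments, as the dagger of a one by
    one matrix is its conjugate. *)
Lemma CD_kernel_dag S H Sh n z1 z2 :
  CD_kernel Sh (bdag H) S n z2 z1 = Num.conj (CD_kernel S H Sh n z1 z2).
Proof.
rewrite /CD_kernel rmorph_sum /=; apply: eq_bigr => j _.
by rewrite -dagE !dag_mul dag_inv dagK mulmxA.
Qed.

End Connection.

(** * Multiplication by a Laurent polynomial on monomials and moments *)

Section Multiplication.
Context {R : realType} {D : nat}.
Implicit Types (al be : multi D) (L : laurent R D) (z : 'I_D -> R[i]).

Lemma mlenD al be : (mlen (al + be)%R <= mlen al + mlen be)%N.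
Proof.
have absD (x y : int) : (absz (x + y)%R <= absz x + absz y)%N by lia.
by rewrite /mlen -big_split; apply: leq_sum => a _; rewrite ffunE; exact: absD.
Qed.

Lemma mlenN al : mlen (- al) = mlen al.
Proof. by apply: eq_bigr => a _; rewrite ffunE abszN. Qed.

Lemma mlen_finsupp L al : L al != 0 -> (mlen al <= ell L)%N.
Proof. by rewrite -mem_finsupp => alL; exact: leq_bigmax_seq. Qed.

(** The blocks partition all multi-indices by length, so a block sum can be reindexed by
    translations and reflections of the lattice. *)
Lemma sum_blocks {V : zmodType} (N : nat) (F : multi D -> V) :
  (forall al, (N <= mlen al)%N -> F al = 0) ->
  \sum_(k < N) \sum_(i < bsz D k) F (bnth i) = \sum_(al \in [set: multi D]) F al.
Proof.
move=> F0; pose s := flatten [seq block D k | k <- index_iota 0 N].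
have mem_s al : (al \in s) = (mlen al < N)%N.
  apply/flatten_mapP/idP => [[k]|alN].
    by rewrite mem_index_iota mem_block => kN /eqP ->.
  by exists (mlen al); rewrite ?mem_block // mem_index_iota.
have us : uniq s.
  have := iota_uniq 0 (N - 0); rewrite /s -/(index_iota 0 N).
  elim: (index_iota 0 N) => //= k r IH /andP[kr ur].
  rewrite cat_uniq block_uniq IH // andbT; apply/hasPn => al /flatten_mapP[p pr].
  by rewrite !mem_block => /eqP ->; apply: contraNneq kr => <-.
rewrite (fsbigE s) //; last by move=> al _; rewrite mem_s -leqNgt => /F0.
rewrite (eq_bigl xpredT) => [|al]; last by rewrite in_setT.
rewrite big_flatten big_map big_mkord.
by apply: eq_bigr => k _; rewrite (big_nth 0) big_mkord.
Qed.

(* [h] is [al |-> be + al] or [al |-> be - al]; [h'] is its inverse. *)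
Lemma sum_blocks_laurent L (F : multi D -> R[i]) (h h' : multi D -> multi D) N :
  cancel h h' -> cancel h' h ->
  (forall al, (mlen al <= ell L)%N -> (mlen (h al) < N)%N) ->
  \sum_(k < N) \sum_(i < bsz D k) L (h' (bnth i)) * F (bnth i) =
  \sum_(al <- finsupp L) L al * F (h al).
Proof.
move=> hK h'K hN.
rewrite (sum_blocks (F := fun al => L (h' al) * F al)) => [|al Nal]; last first.
  apply/eqP; rewrite mulf_eq0; apply/orP; left; apply: contraTT Nal.
  by move=> /mlen_finsupp/hN; rewrite h'K -ltnNge.
rewrite (fsbigE [seq h al | al <- finsupp L]) //; last 2 first.
- by rewrite map_inj_uniq ?fset_uniq //; exact: can_inj hK.
- move=> al _; rewrite -{1}(h'K al) mem_map; last exact: can_inj hK.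
  by rewrite mem_finsupp negbK => /eqP ->; rewrite mul0r.
rewrite (eq_bigl xpredT) => [|al]; last by rewrite in_setT.
by rewrite big_map; apply: eq_bigr => al _; rewrite hK.
Qed.

(** By the triangle inequality, a nonzero coefficient shifts the length of a multi-index by at most
    [ell L]. *)
Lemma lUpsilon_band L k l : (k + ell L < l)%N -> lUpsilon L k l = 0.
Proof.
move=> kl; apply/matrixP => i j; rewrite !mxE; apply/eqP; apply: contraTT kl.
move=> /mlen_finsupp h; rewrite -leqNgt -(mlen_bnth j) -(subrK (bnth i) (bnth j)).
by rewrite (leq_trans (mlenD _ _)) // mlen_bnth addnC leq_add2l.
Qed.

Lemma dag_lUpsilon_band L k l : (k + ell L < l)%N -> bdag (lUpsilon L) k l = 0.
Proof.
move=> kl; apply/matrixP => i j; rewrite !mxE.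
suff -> : L (bnth i - bnth j) = 0 by rewrite rmorph0.
apply/eqP; apply: contraTT kl => /mlen_finsupp h.
rewrite -leqNgt -(mlen_bnth j) -(subKr (bnth i) (bnth j)).
by rewrite (leq_trans (mlenD _ _)) // mlenN mlen_bnth leq_add2l.
Qed.

Lemma lbarE L al : lbar L al = Num.conj (L al).
Proof. by rewrite fsfun_fun; case: finsuppP => //; rewrite rmorph0. Qed.

Lemma finsupp_lbar L : finsupp (lbar L) = finsupp L.
Proof.
by apply/fsetP => al; rewrite !mem_finsupp lbarE fmorph_eq0.
Qed.

Lemma mul_lUpsilon_chi L z : (forall a, z a != 0) ->
  bmulc (lUpsilon L) (chi z) = (fun k => leval L z *: chi z k).
Proof.
move=> z0; apply: bcolP => k.
rewrite (@bmulcE _ _ _ _ _ (k + ell L).+1) => [|p kp]; last first.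
  by rewrite lUpsilon_band ?mul0mx.
apply/matrixP => i j; rewrite summxE !mxE mulr_suml.
transitivity (\sum_(al <- finsupp L) L al * zpow z (bnth i + al)); last first.
  by apply: eq_bigr => al _; rewrite zpowD //; ring.
rewrite -(sum_blocks_laurent _ (h' := fun be => be - bnth i) (N := (k + ell L).+1)).
- apply: eq_bigr => p _; rewrite mxE; apply: eq_bigr => q _; rewrite !mxE //.
- by move=> al; rewrite addrC addKr.
- by move=> al; rewrite addrC subrK.
- move=> al h; rewrite ltnS (leq_trans (mlenD _ _)) // mlen_bnth leq_add2l //.
Qed.

(** The dagger reverses the shift: row [be] collects the conjugate coefficients of [L] times [z] to
    the power [be - al], which is the value of [lbar L] at the inverse point times a monomial. *)
Lemma mul_dag_lUpsilon_chi L z : (forall a, z a != 0) ->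
  bmulc (bdag (lUpsilon L)) (chi z) =
  (fun k => leval (lbar L) (zinv z) *: chi z k).
Proof.
move=> z0; apply: bcolP => k.
rewrite (@bmulcE _ _ _ _ _ (k + ell L).+1) => [|p kp]; last first.
  by rewrite dag_lUpsilon_band ?mul0mx.
apply/matrixP => i j; rewrite summxE !mxE mulr_suml.
transitivity (\sum_(al <- finsupp (lbar L)) lbar L al * zpow z (bnth i - al)); last first.
  by apply: eq_bigr => al _; rewrite zpow_zinv zpowD //; ring.
rewrite -(sum_blocks_laurent _ (h' := fun be => bnth i - be) (N := (k + ell L).+1)).
- apply: eq_bigr => p _; rewrite mxE; apply: eq_bigr => q _; rewrite !mxE lbarE //.
- exact: subKr.
- exact: subKr.
- move=> al; rewrite {1}/ell finsupp_lbar => h.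
  by rewrite ltnS (leq_trans (mlenD _ _)) // mlen_bnth mlenN leq_add2l.
Qed.

Lemma moment_matrix_mull (mu : torus_measure R D) L :
  moment_matrix mu (leval L) = bmul (lUpsilon L) (moment_matrix mu (fun=> 1)).
Proof.
apply: bmxP => k l; rewrite (@bmulE _ _ _ _ _ _ (k + ell L).+1) => [|p kp]; last first.
  by rewrite lUpsilon_band ?mul0mx.
apply/matrixP => i j; rewrite moment_matrixE summxE.
rewrite -(sum_blocks_laurent (fun be => moment mu (be - bnth j))
  (h := fun al => bnth i + al) (h' := fun be => be - bnth i) (N := (k + ell L).+1)).
- apply: eq_bigr => p _; rewrite mxE; apply: eq_bigr => q _.
  by rewrite moment_matrix1E !mxE.
- by move=> al; rewrite addrC addKr.
- by move=> al; rewrite addrC subrK.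
- by move=> al h; rewrite ltnS (leq_trans (mlenD _ _)) // mlen_bnth leq_add2l.
Qed.

(** The same moments absorb the shift into the column index, so [L] also acts from the right; the
    daggered form matches the hypothesis [TGE] for the adjoint problem. *)
Lemma moment_matrix_mulr (mu : torus_measure R D) L :
  bdag (moment_matrix mu (leval L)) =
  bmul (bdag (lUpsilon L)) (bdag (moment_matrix mu (fun=> 1))).
Proof.
apply: bmxP => k l; rewrite (@bmulE _ _ _ _ _ _ (k + ell L).+1) => [|p kp]; last first.
  by rewrite dag_lUpsilon_band ?mul0mx.
apply/matrixP => i j; rewrite dagE moment_matrixE summxE.
rewrite (eq_bigr (fun al => L al * moment mu (bnth j - (bnth i - al)))); last first.
  by move=> al _; rewrite opprB addrA.
rewrite -(sum_blocks_laurent (fun be => moment mu (bnth j - be))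
  (h := fun al => bnth i - al) (h' := fun be => bnth i - be) (N := (k + ell L).+1)).
- rewrite rmorph_sum /=; apply: eq_bigr => p _; rewrite mxE rmorph_sum /=.
  by apply: eq_bigr => q _; rewrite !dagE moment_matrix1E !mxE rmorphM.
- exact: subKr.
- exact: subKr.
- move=> al h; rewrite ltnS (leq_trans (mlenD _ _)) // mlen_bnth.
  by rewrite mlenN leq_add2l.
Qed.

End Multiplication.

Unset Implicit Arguments.

Theorem theorem3p5 (R : realType) (D : nat) (hD : (1 <= D)%N)
    (mu : torus_measure R D) (L : laurent R D) (m : nat) (hm : ell L = m)
    (mu_qd : quasi_definite (moment_matrix mu (fun=> 1)))
    (Tmu_qd : quasi_definite (moment_matrix mu (leval L)))
    (S H Sh TS TH TSh : bmx R D)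
    (fact : gauss_borel (moment_matrix mu (fun=> 1)) S H Sh)
    (Tfact : gauss_borel (moment_matrix mu (leval L)) TS TH TSh)
    (l : nat) (z1 z2 : 'I_D -> R[i])
    (hz1 : forall a : 'I_D, z1 a != 0) (hz2 : forall a : 'I_D, z2 a != 0) :
  let K := CD_kernel S H Sh in
  let TK := CD_kernel TS TH TSh in
  let omega := resolvent TS (lUpsilon L) S in
  let omegah := resolvent TSh (bdag (lUpsilon L)) Sh in
  let THinv := invmx (diag_part TH l m) in
  [/\ K (l + m)%N z1 z2 =
        leval L z2 * TK (l + m)%N z1 z2
        - (dag (stack (phi TSh z1) l m) *m THinv
           *m lower_part omega l m *m stack (phi S z2) (l + m) m) 0 0,
      K (l + m)%N z1 z2 =
        leval L z2 * TK l z1 z2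
        + (dag (stack (phi TSh z1) l m) *m THinv
           *m upper_part omega l m *m stack (phi S z2) l m) 0 0,
      K (l + m)%N z1 z2 =
        Num.conj (leval (lbar L) (zinv z1)) * TK (l + m)%N z1 z2
        - (dag (stack (phi Sh z1) (l + m) m) *m dag (lower_part omegah l m)
           *m THinv *m stack (phi TS z2) l m) 0 0
    & K (l + m)%N z1 z2 =
        Num.conj (leval (lbar L) (zinv z1)) * TK l z1 z2
        + (dag (stack (phi Sh z1) l m) *m dag (upper_part omegah l m)
           *m THinv *m stack (phi TS z2) l m) 0 0].
Proof.
move=> K TK omega omegah THinv; subst m.
have [K1 K2] := CD_kernel_connection fact Tfact (moment_matrix_mull mu L)
  (@lUpsilon_band _ _ L) z1 (mul_lUpsilon_chi L hz2) l.
(* The adjoint problem is taken with [z1] and [z2] exchanged, so its eigenvalue is that of the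
   dagger at [z1]. *)
have [K3 K4] := CD_kernel_connection (gauss_borel_dag fact) (gauss_borel_dag Tfact)
  (moment_matrix_mulr mu L) (@dag_lUpsilon_band _ _ L) z2 (mul_dag_lUpsilon_chi L hz1) l.
(* Conjugating the scalar reverses the order of the factors and turns the dagger of [TH] back into
   [TH]. *)
have conj_form l' (A : 'M[R[i]]_(_, \sum_(j < ell L) bsz D (l' + j))) :
    Num.conj ((dag (stack (phi TS z2) l (ell L)) *m invmx (diag_part (bdag TH) l (ell L))
      *m A *m stack (phi Sh z1) l' (ell L)) 0 0) =
    (dag (stack (phi Sh z1) l' (ell L)) *m dag A *m THinv
      *m stack (phi TS z2) l (ell L)) 0 0.
  rewrite -dagE !dag_mul dagK dag_inv !mulmxA.
  by rewrite /THinv /diag_part dag_mxdiag; under eq_mxdiag do rewrite /bdag dagK.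
rewrite !CD_kernel_dag in K3 K4.
(* [K3] and [K4] concern conjugate kernels; conjugating them once more puts the conjugate on the
   scalar factor. *)
have conj_eq (x y b c : R[i]) : Num.conj x = c * Num.conj y + b ->
    x = Num.conj c * y + Num.conj b.
  by move/(congr1 Num.conj); rewrite rmorphD rmorphM /= !conjCK.
split; [exact: K1 | exact: K2 | |].
- by rewrite -conj_form -rmorphN; exact: conj_eq.
- by rewrite -conj_form; exact: conj_eq.
Qed.
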